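(* Let $F$ be a field of characteristic two and let $\sigma$ be an orthogonal involution on a central simple $F$-algebra $A$. Let $S(A,\sigma)$ be the alternator subalgebra and $q_\sigma$ the alternator form of $(A,\sigma)$. Then the following conditions are equivalent: (1) $\sigma$ is direct. (2) $q_\sigma$ is anisotropic. (3) $S(A,\sigma)$ is a field. Moreover, if these conditions hold, then $x^2\in F$ for all $x\in S(A,\sigma)$.
   Context: $F$ is a field of characteristic two; central simple algebras are finite-dimensional. An involution $\sigma$ on a central simple $F$-algebra $A$ is an anti-automorphism of order two; it is of the first kind if it is the identity on $F$. Put $\mathrm{Alt}(A,\sigma)=\{x-\sigma(x)\mid x\in A\}$. An involution of the first kind is orthogonal if and only if $1\notin\mathrm{Alt}(A,\sigma)$ (equivalently, over a splitting field of $A$ it is adjoint to a non-alternating symmetric bilinear form). For $\sigma$ orthogonal, define the alternator subalgebra $S(A,\sigma)=\{x\in A\mid \sigma(x)x\in F\oplus\mathrm{Alt}(A,\sigma)\}$ (it is a unitary $F$-subalgebra of $A$) and, for $x\in S(A,\sigma)$, let $q_\sigma(x)$ be the unique element of $F$ with $\sigma(x)x+q_\sigma(x)\in\mathrm{Alt}(A,\sigma)$; the map $q_\sigma:S(A,\sigma)\to F$ is a totally singular quadratic form (i.e. a quadratic form whose polar form is zero), called the alternator form. A quadratic form $q$ is isotropic if $q(v)=0$ for some $v\neq0$, anisotropic otherwise. The involution $\sigma$ is called direct if for every $x\in A$ the condition $\sigma(x)x\in\mathrm{Alt}(A,\sigma)$ implies $x=0$. *)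

(* Defs.v *)
From HB Require Import structures.
From mathcomp Require Import all_boot all_order all_algebra all_field.
From mathcomp Require Import boolp classical_sets.

Set Implicit Arguments.
Unset Strict Implicit.
Unset Printing Implicit Defensive.

Import GRing.Theory.
Local Open Scope classical_set_scope.
Local Open Scope ring_scope.

Section CentralSimple.
Variables (F : fieldType) (A : falgType F).

Definition two_sided_ideal (I : set A) : Prop :=
  [/\ I 0,
      forall x y, I x -> I y -> I (x - y),
      forall a x, I x -> I (a * x) &
      forall a x, I x -> I (x * a)].

(* Finite dimension and [1 != 0] are part of [falgType]. *)
Definition central_simple : Prop :=
  (forall z : A, (forall x, z * x = x * z) -> exists a : F, z = a%:A) /\
  (forall I : set A, two_sided_ideal I -> I = [set 0] \/ I = setT).

End CentralSimple.

Section Involutions.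
Variables (F : fieldType) (A : falgType F) (s : A -> A).

(* [s] is allowed to be the identity, which can only happen when [A] is
   commutative; a central algebra is then [F] itself. *)
Definition involution : Prop :=
  [/\ {morph s : x y / x + y},
      forall x y, s (x * y) = s y * s x &
      involutive s].

Definition first_kind : Prop := forall a : F, s a%:A = a%:A.

Definition Alt : set A := [set x - s x | x in setT].

Definition orthogonal_involution : Prop :=
  [/\ involution, first_kind & ~ Alt 1].

Definition direct_involution : Prop := forall x : A, Alt (s x * x) -> x = 0.

(* For orthogonal [s] the sum F + Alt(A, s) is direct, since 1 is not in
   the subspace Alt(A, s). *)
Definition scalars_plus_Alt : set A :=
  [set y | exists (a : F) (b : A), Alt b /\ y = a%:A + b].

Definition alternator : set A := [set x | scalars_plus_Alt (s x * x)].

(* The value is meaningful for [x] in [alternator] only, see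
   [alternator_formP]; it is 0 elsewhere. *)
Definition alternator_form (x : A) : F :=
  xget 0 [set a : F | Alt (s x * x + a%:A)].

End Involutions.

Section Subsets.
Variables (F : fieldType) (A : falgType F).

Definition anisotropic_on (V : set A) (q : A -> F) : Prop :=
  forall v, V v -> v != 0 -> q v != 0.

Definition is_field (K : set A) : Prop :=
  [/\ [/\ K 1, forall x y, K x -> K y -> K (x - y)
         & forall x y, K x -> K y -> K (x * y)],
      forall x y, K x -> K y -> x * y = y * x &
      forall x, K x -> x != 0 -> exists2 y, K y & x * y = 1].

End Subsets.

Section AlternatorTheory.
Variables (F : fieldType) (A : falgType F) (s : A -> A).
Hypothesis char2 : 2%N \in [pchar F].
Hypothesis s_orth : orthogonal_involution s.

Let addxx (x : A) : x + x = 0.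
Proof. by rewrite -mulr2n -scaler_nat pcharf0 // scale0r. Qed.

Let oppx (x : A) : - x = x.
Proof. by apply/eqP; rewrite eq_sym -addr_eq0 addxx. Qed.

Let sD : {morph s : x y / x + y}. Proof. by case: s_orth => -[] ? ? ?. Qed.
Let sM x y : s (x * y) = s y * s x. Proof. by case: s_orth => -[] ? ? ?. Qed.
Let sK : involutive s. Proof. by case: s_orth => -[] ? ? ?. Qed.
Let sF (a : F) : s a%:A = a%:A. Proof. by case: s_orth. Qed.
Let sZ (a : F) x : s (a *: x) = a *: s x.
Proof. by rewrite -[a *: x]mulr_algl sM sF mulr_algr. Qed.

Let AltD x y : Alt s x -> Alt s y -> Alt s (x + y).
Proof.
move=> [u _ <-] [v _ <-]; exists (u + v) => //.
by rewrite sD opprD addrACA.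
Qed.

Let AltZ (a : F) x : Alt s x -> Alt s (a *: x).
Proof. by move=> [u _ <-]; exists (a *: u) => //; rewrite sZ scalerBr. Qed.

Let AltJ x y : Alt s x -> Alt s (s y * x * y).
Proof.
move=> [u _ <-]; exists (s y * u * y) => //.
by rewrite !sM sK mulrBr mulrBl mulrA.
Qed.

Lemma alternator_form_uniq x (a b : F) :
  Alt s (s x * x + a%:A) -> Alt s (s x * x + b%:A) -> a = b.
Proof.
move=> Ha Hb; apply/eqP; apply: contraT => ab.
case: s_orth => _ _ []; have := AltD Ha Hb.
rewrite addrACA addxx add0r -scalerDl => /(@AltZ (a + b)^-1).
rewrite scalerA mulVf ?scale1r // addr_eq0.
by rewrite (oppr_pchar2 char2).
Qed.

Lemma alternator_formP x :
  alternator s x -> Alt s (s x * x + (alternator_form s x)%:A).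
Proof.
move=> [a [b [bA e]]]; apply: (@xgetPex F 0 [set a0 | Alt s (s x * x + a0%:A)]).
by exists a; rewrite /= e addrAC addxx add0r.
Qed.

Lemma alternator_subalgebra :
  [/\ alternator s 1,
      forall (a : F) x y,
        alternator s x -> alternator s y -> alternator s (a *: x + y) &
      forall x y, alternator s x -> alternator s y -> alternator s (x * y)].
Proof.
have A0 : Alt s 0.
  by exists 0; rewrite ?subr0 -(scale0r (1 : A)) ?sF ?subrr ?scale0r.
have s1 : s 1 = 1 by rewrite -(scale1r (1 : A)) sF.
split.
- by exists 1, 0; split=> //; rewrite mulr1 s1 scale1r addr0.
- move=> a x y [b [u [uA eu]]] [c [v [vA ev]]].
  pose w := s (a *: x) * y.
  exists (a * a * b + c), ((a * a) *: u + v + (w - s w)).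
  split.
    by apply: (AltD (AltD (AltZ _ uA) vA)); exists w.
  rewrite oppx {2}/w sM sK sD mulrDl !mulrDr ev sZ -/w.
  rewrite -scalerAl -scalerAr scalerA eu scalerDr scalerA scalerDl.
  rewrite -sZ -/w.
  by rewrite [RHS](AC (2*(2*2)) (((1*3)*5)*(6*(2*4)))).
- move=> x y [b [u [uA eu]]] [c [v [vA ev]]].
  exists (b * c), (b *: v + s y * u * y).
  split; first by apply: AltD; [apply: AltZ | apply: AltJ].
  rewrite sM mulrA -(mulrA (s y)) eu mulrDr mulrDl mulr_algr -scalerAl ev.
  by rewrite scalerDr scalerA addrA.
Qed.

End AlternatorTheory.

(* Main.v *)
(* Modulo Alt(A, s), the map x |-> s(x) x is additive, and it multiplies by
   q(x) when its argument is multiplied on the left by x in S(A, s). If s is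
   direct the map is injective, so x^2 = q(x) because both sides are sent to
   q(x)^2, and x y = y x because both sides are sent to q(x) q(y). Conversely,
   if x y = 1 and s(x) x is in Alt(A, s), then so is 1 = s(y) (s(x) x) y. *)
Require Import Defs.
From mathcomp Require Import all_boot all_order all_algebra all_field.
From mathcomp Require Import boolp classical_sets.

Import GRing.Theory.
Local Open Scope ring_scope.

Section Alternator.
Set Implicit Arguments.
Unset Strict Implicit.
Variables (F : fieldType) (A : falgType F) (s : A -> A).
Hypothesis char2 : 2%N \in [pchar F].
Hypothesis s_orth : orthogonal_involution s.

Lemma oppr_falg_pchar2 (x : A) : - x = x.
Proof.
by apply/eqP; rewrite eq_sym -addr_eq0 -mulr2n -scaler_nat pcharf0 // scale0r.
Qed.

Lemma orth_invD : {morph s : x y / x + y}.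
Proof. by case: s_orth => -[]. Qed.

Lemma orth_invM x y : s (x * y) = s y * s x.
Proof. by case: s_orth => -[]. Qed.

Lemma orth_invK : involutive s.
Proof. by case: s_orth => -[]. Qed.

Lemma orth_inv_scalar (a : F) : s a%:A = a%:A.
Proof. by case: s_orth. Qed.

Lemma orth_inv1 : s 1 = 1.
Proof. by rewrite -(scale1r (1 : A)) orth_inv_scalar. Qed.

Lemma orth_invZ (a : F) x : s (a *: x) = a *: s x.
Proof. by rewrite -[a *: x]mulr_algl orth_invM orth_inv_scalar mulr_algr. Qed.

Lemma Alt0 : Alt s 0.
Proof. by exists 1; rewrite // orth_inv1 subrr. Qed.

Lemma AltD x y : Alt s x -> Alt s y -> Alt s (x + y).
Proof.
move=> [u _ <-] [v _ <-]; exists (u + v) => //.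
by rewrite orth_invD opprD addrACA.
Qed.

Lemma AltZ (a : F) x : Alt s x -> Alt s (a *: x).
Proof. by move=> [u _ <-]; exists (a *: u); rewrite // orth_invZ scalerBr. Qed.

Lemma Alt_conj x y : Alt s x -> Alt s (s y * x * y).
Proof.
move=> [u _ <-]; exists (s y * u * y) => //.
by rewrite !orth_invM orth_invK mulrBr mulrBl mulrA.
Qed.

Lemma Alt_alternator x : Alt s (s x * x) -> alternator s x.
Proof. by move=> xA; exists 0, (s x * x); rewrite scale0r add0r. Qed.

(** The scalar that brings [s x * x] into [Alt s] is unique, and membership in [Alt s] says that 0
    is such a scalar. *)
Lemma alternator_form_eq0 x :
  alternator s x -> (alternator_form s x = 0) <-> Alt s (s x * x).
Proof.
move=> Sx; have H := alternator_formP char2 Sx; split=> [q0|xA].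
  by move: H; rewrite q0 scale0r addr0.
by apply: (alternator_form_uniq char2 s_orth H); rewrite scale0r addr0.
Qed.

(** Directness quantifies over all of [A], but an [x] with [s x * x] in [Alt s] already lies in
    [alternator s], so only zeros of the form matter. *)
Lemma direct_anisotropic :
  direct_involution s <-> anisotropic_on (alternator s) (alternator_form s).
Proof.
split=> [dir x Sx|aniso x xA].
  by apply: contra_neq => /(alternator_form_eq0 Sx)/dir.
have Sx := Alt_alternator xA.
apply/eqP; apply: contraT => /(aniso x Sx) /eqP[].
exact/alternator_form_eq0.
Qed.

(** Conjugate [s x * x + q(x)], an element of [Alt s], to [s y * _ * y]; the scalar q(x) commutes
    past [s y]. *)
Lemma alternator_norm_mul x y : alternator s x ->
  Alt s (s (x * y) * (x * y) - alternator_form s x *: (s y * y)).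
Proof.
move=> /(alternator_formP char2) /Alt_conj -/(_ y).
rewrite orth_invM !mulrDr !mulrDl mulr_algr -scalerAl !mulrA.
by rewrite oppr_falg_pchar2.
Qed.

(** [z] is a common representative of both norms modulo [Alt s]; it suffices that the norm of
    [x - y] lies in [Alt s]. *)
Lemma direct_inj x y z : direct_involution s ->
  Alt s (s x * x - z) -> Alt s (s y * y - z) -> x = y.
Proof.
move=> dir xA yA; apply/eqP; rewrite -subr_eq0; apply/eqP/dir.
(* These are the cross terms of [s (x - y) * (x - y)], since signs do not matter and
   [s (s x * y) = s y * x]. *)
have wA : Alt s (s x * y - s (s x * y)) by exists (s x * y).
move: (AltD (AltD xA yA) wA).
rewrite orth_invM orth_invK !oppr_falg_pchar2 orth_invD mulrDl !mulrDr.
rewrite [X in Alt s X -> _](AC (2*2*2) ((1*5)*(6*3)*(2*4))) /=.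
have -> : z + z = 0 by rewrite -{1}[z]oppr_falg_pchar2 addNr.
by rewrite addr0.
Qed.

Lemma alternator_norm_mul2 x y : alternator s x -> alternator s y ->
  Alt s (s (x * y) * (x * y) - (alternator_form s x * alternator_form s y)%:A).
Proof.
move=> Sx Sy; have := alternator_formP char2 Sy.
move=> /(AltZ (alternator_form s x)) /(AltD (alternator_norm_mul y Sx)).
by rewrite scalerDr scalerA addrA subrK oppr_falg_pchar2.
Qed.

Lemma direct_alternator_comm x y : direct_involution s ->
  alternator s x -> alternator s y -> x * y = y * x.
Proof.
move=> dir Sx Sy; apply: direct_inj dir (alternator_norm_mul2 Sx Sy) _.
(* Commutativity of [F] gives both products the same representative. *)
by rewrite mulrC; apply: alternator_norm_mul2.
Qed.

Lemma direct_alternator_sqr x : direct_involution s ->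
  alternator s x -> x ^+ 2 = (alternator_form s x)%:A.
Proof.
move=> dir Sx; rewrite expr2.
apply: direct_inj dir (alternator_norm_mul2 Sx Sx) _.
rewrite orth_inv_scalar mulr_algl scalerA subrr.
exact: Alt0.
Qed.

Lemma direct_alternator_is_field :
  direct_involution s -> is_field (alternator s).
Proof.
move=> dir; have [S1 SL SM] := alternator_subalgebra char2 s_orth.
split=> [|x y|x Sx x0].
- split=> // x y Sx Sy.
  by rewrite addrC -scaleN1r; apply: SL.
- exact: direct_alternator_comm.
have qx0 := direct_anisotropic.1 dir x Sx x0.
(* The inverse is read off from x^2 = q(x), where q(x) is nonzero by anisotropy. *)
exists ((alternator_form s x)^-1 *: x); last first.
  by rewrite -scalerAr -expr2 direct_alternator_sqr // scalerA mulVf // scale1r.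
(* The added 0 matches the shape [a *: x + y] of the closure property; 0 itself lies in
   [alternator s], having norm 0. *)
rewrite -[_ *: _]addr0; apply: (SL) => //.
by apply: Alt_alternator; rewrite mulr0; apply: Alt0.
Qed.

Lemma alternator_field_direct :
  is_field (alternator s) -> direct_involution s.
Proof.
move=> [_ _ inv] x xA; apply/eqP; apply: contraT => x0.
have [y _ xy1] := inv x (Alt_alternator xA) x0.
have [_ _ []] := s_orth.
move: (Alt_conj y xA).
by rewrite mulrA -orth_invM -mulrA xy1 orth_inv1 mulr1.
Qed.

End Alternator.

Theorem theorem3p7 (F : fieldType) (A : falgType F) (s : A -> A)
    (char2 : 2%N \in [pchar F]) (csA : central_simple A)
    (s_orth : orthogonal_involution s) :
  [/\ direct_involution s <->
        anisotropic_on (alternator s) (alternator_form s),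
      anisotropic_on (alternator s) (alternator_form s) <->
        is_field (alternator s)
    & direct_involution s ->
        forall x : A, alternator s x -> exists a : F, x ^+ 2 = a%:A].
Proof.
have dirP := direct_anisotropic char2 s_orth.
split=> //.
(* Both directions pass through directness. *)
- split=> [/dirP|SF]; first exact: direct_alternator_is_field.
  exact/dirP/alternator_field_direct.
- move=> dir x Sx; exists (alternator_form s x).
  exact: direct_alternator_sqr.
Qed.
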